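(* If $\kappa\in\Omega^k(\mathbb{R}^{2n+1})$, $n+1\le k\le2n$, then there are smooth forms $$\beta\in\Omega^{k-1}(\mathbb{R}^{2n+1})\quad\text{and}\quad\gamma\in\Omega^{2n-k}(\mathbb{R}^{2n+1})$$ that do not contain components with $dt$, and satisfy $$\kappa=\beta\wedge\alpha+\gamma\wedge(d\alpha)^{k-n}.$$ Moreover, if $\kappa(p)=0$ at a point $p\in\mathbb{R}^{2n+1}$, then $\beta(p)=0$ and $\gamma(p)=0$.
   Context: $\Omega^k(\mathbb{R}^{2n+1})$ denotes smooth differential $k$-forms. Coordinates in $\mathbb{R}^{2n+1}$ are $(x_1,y_1,\dots,x_n,y_n,t)$, and $\alpha=dt+2\sum_{j=1}^n(x_j\,dy_j-y_j\,dx_j)$ is the standard contact form, so $d\alpha=4\sum_{j=1}^ndx_j\wedge dy_j$. $(d\alpha)^{j}$ is the $j$-fold wedge product. A form does not contain components with $dt$ if at every point it is a linear combination of the covectors $dx_I\wedge dy_J$. *)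

(* Defs.v *)
From HB Require Import structures.
From mathcomp Require Import all_boot all_order all_algebra.
From mathcomp Require Import all_classical all_reals all_analysis.
Set Implicit Arguments.
Unset Strict Implicit.
Unset Printing Implicit Defensive.
Import Order.TTheory GRing.Theory Num.Theory numFieldNormedType.Exports.
Local Open Scope classical_set_scope.
Local Open Scope ring_scope.

Section Exterior.
Variables (R : realType) (N : nat).

(* The exterior algebra of the dual of R^N, in the basis dz_K, where
   dz_K = dz_(i_1) /\ ... /\ dz_(i_k) for K = {i_1 < ... < i_k}:
   a is the element \sum_K a K *: dz_K. *)
Definition ext := {ffun {set 'I_N} -> R^o}.

Definition ext1 : ext := [ffun K : {set 'I_N} => (K == finset.set0)%:R].

Definition dz (i : 'I_N) : ext := [ffun K : {set 'I_N} => (K == [set i]%SET)%:R].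

(* dz_I /\ dz_J = (-1) ^ (inversions I J) dz_(I :|: J) for disjoint I and J. *)
Definition inversions (I J : {set 'I_N}) : nat :=
  #|[set ij : 'I_N * 'I_N | [&& ij.1 \in I, ij.2 \in J & (ij.2 < ij.1)%N]]%SET|.

Definition wedge (a b : ext) : ext :=
  [ffun K : {set 'I_N} => \sum_(I : {set 'I_N} | I \subset K)
     (-1) ^+ inversions I (K :\: I)%SET * a I * b (K :\: I)%SET].

Definition wedge_pow (a : ext) (m : nat) : ext := iter m (wedge a) ext1.

Definition homogeneous (k : nat) (a : ext) : Prop :=
  forall K : {set 'I_N}, #|K| != k -> a K = 0.

End Exterior.

Section Forms.
Variables (R : realType) (N : nat).
Implicit Types f : 'rV[R]_N -> R.

Definition partial_derivative (i : 'I_N) f : 'rV[R]_N -> R :=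
  fun p => 'D_(delta_mx 0 i) f p.

(* foldr partial_derivative f [:: i_1; ...; i_m] is
   d/dz_(i_1) ( ... (d/dz_(i_m) f)). *)
Definition smooth f : Prop :=
  forall s : seq 'I_N,
    continuous (foldr partial_derivative f s) /\
    forall p i, derivable (foldr partial_derivative f s) p (delta_mx 0 i).

Definition diff_form := 'rV[R]_N -> ext R N.

Definition Omega (k : nat) : set diff_form :=
  [set w | (forall p, homogeneous k (w p)) /\
           (forall K : {set 'I_N}, smooth (fun p => w p K))].

Definition ext_d (w : diff_form) : diff_form := fun p =>
  \sum_(i < N) wedge (dz R i)
    [ffun K : {set 'I_N} => partial_derivative i (fun q => w q K) p].

End Forms.

Section Contact.
Variables (R : realType) (n : nat).

(* The coordinates of R^(2n+1) are ordered as x_1, y_1, ..., x_n, y_n, t. *)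
Definition xc (j : 'I_n) : 'I_(2 * n).+1 := inord (2 * j).
Definition yc (j : 'I_n) : 'I_(2 * n).+1 := inord (2 * j).+1.
Definition tc : 'I_(2 * n).+1 := ord_max.

Definition contact_form : diff_form R (2 * n).+1 := fun p =>
  dz R tc + 2 *: \sum_(j < n)
    (p ord0 (xc j) *: dz R (yc j) - p ord0 (yc j) *: dz R (xc j)).

Definition dx_ (I : {set 'I_n}) : ext R (2 * n).+1 :=
  \big[@wedge R (2 * n).+1/@ext1 R (2 * n).+1]_(j in I) dz R (xc j).
Definition dy_ (J : {set 'I_n}) : ext R (2 * n).+1 :=
  \big[@wedge R (2 * n).+1/@ext1 R (2 * n).+1]_(j in J) dz R (yc j).

Definition without_dt (w : diff_form R (2 * n).+1) : Prop :=
  forall p, exists c : {set 'I_n} -> {set 'I_n} -> R,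
    w p = \sum_(I : {set 'I_n}) \sum_(J : {set 'I_n})
            c I J *: wedge (dx_ I) (dy_ J).

End Contact.

Arguments Omega : clear implicits.
Arguments contact_form : clear implicits.

(* Main.v *)
Require Import Defs.
From HB Require Import structures.
From mathcomp Require Import all_boot all_order all_algebra.
From mathcomp Require Import all_classical all_reals all_analysis.
From mathcomp Require Import ring zify.
Set Implicit Arguments.
Unset Strict Implicit.
Unset Printing Implicit Defensive.
Import Order.TTheory GRing.Theory Num.Theory numFieldNormedType.Exports.
Local Open Scope ring_scope.

(* Write m = k - n and let t be the last coordinate. The form beta is forced to
   be the coefficient of dt in kappa; then kappa - beta /\ alpha has no dt, and it
   remains to invert, with constant coefficients, multiplication by (d alpha)^m
   from horizontal (n - m)-forms to horizontal (n + m)-forms.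

   This is the linear Lefschetz theorem. Up to the factor 4, d alpha acts on
   horizontal covectors as L = \sum_j E_j, where E_j is multiplication by
   dx_j /\ dy_j; the E_j commute and have square zero. A monomial dz_K splits as
   a product of "singles" (exactly one of dx_j, dy_j) and of full pairs
   E_j, so it suffices to show, for a finite family T of such operators and a
   vector v, that L^m maps products of b factors onto products of b + m factors
   when |T| = 2 b + m. Induction on T: to solve, for m > 0,
     (L + E_j)^m (u1 + E_j u2) = A + E_j B,
   write A = L^(m+1) a, B = L^(m-1) w and L^m w = L^(m+1) c by the induction
   hypothesis, and take u1 = (w - L c) / m + L a and u2 = c - m a. *)

(** * Monomials and bilinearity of the wedge product *)

Section ExteriorTheory.
Variables (R : realType) (N : nat).
Implicit Types (a b : ext R N) (I J K : {set 'I_N}).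

(** The basis monomial dz_K. By conversion, [dz R i] is its instance at a singleton and [ext1] its
    instance at the empty set. *)
Definition dzs K : ext R N := [ffun K' : {set 'I_N} => (K' == K)%:R].

Lemma ext_sum_dzs a : a = \sum_K a K *: dzs K.
Proof.
apply/ffunP => K; rewrite sum_ffunE (bigD1 K) //= big1 => [|K' /negPf neK].
  by rewrite !ffunE eqxx addr0 /GRing.scale /= mulr1.
by rewrite !ffunE eq_sym neK /GRing.scale /= mulr0.
Qed.

Lemma inversionsE I J :
  inversions I J = (\sum_(i in I) \sum_(j in J) (j < i))%N.
Proof.
rewrite /inversions -sum1_card pair_big big_mkcond [RHS]big_mkcond /=.
apply: eq_bigr => -[i j] _ /=; rewrite inE /=.
by case: (i \in I); case: (j \in J); case: (j < i)%N.
Qed.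

Lemma inversionsUr I J K : [disjoint J & K] ->
  inversions I (J :|: K)%SET = (inversions I J + inversions I K)%N.
Proof.
move=> dJK; rewrite !inversionsE -big_split; apply: eq_bigr => i _.
by rewrite -bigU //; apply: eq_bigl => j; rewrite !inE.
Qed.

Lemma inversions0r I : inversions I finset.set0 = 0%N.
Proof. by rewrite inversionsE big1 // => i _; rewrite big_set0. Qed.

Lemma wedge_is_linear a : linear (wedge a).
Proof.
move=> c b1 b2; apply/ffunP => K; rewrite !ffunE scaler_sumr -big_split /=.
apply: eq_bigr => I _; rewrite !ffunE mulrDr; congr (_ + _).
exact: mulrCA.
Qed.
HB.instance Definition _ a :=
  GRing.isLinear.Build R (ext R N) (ext R N) _ (wedge a) (wedge_is_linear a).

(** Exchanging the arguments lets linearity in the left factor be registered as an instance too. *)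
Definition wedger b a := wedge a b.

Lemma wedger_is_linear b : linear (wedger b).
Proof.
move=> c a1 a2; apply/ffunP => K; rewrite !ffunE scaler_sumr -big_split /=.
apply: eq_bigr => I _; rewrite !ffunE mulrDr mulrDl; congr (_ + _).
by rewrite /GRing.scale /= !mulrA [_ * c]mulrC.
Qed.
HB.instance Definition _ b :=
  GRing.isLinear.Build R (ext R N) (ext R N) _ (wedger b) (wedger_is_linear b).

Lemma wedge0l b : wedge 0 b = 0.
Proof. exact: (raddf0 (wedger b)). Qed.

Lemma wedgeZl (c : R) a b : wedge (c *: a) b = c *: wedge a b.
Proof. exact: (linearZ_LR (wedger b)). Qed.

Lemma wedgeZr (c : R) a b : wedge a (c *: b) = c *: wedge a b.
Proof. exact: linearZ_LR. Qed.

Lemma wedge_suml T (r : seq T) (P : pred T) (F : T -> ext R N) b :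
  wedge (\sum_(i <- r | P i) F i) b = \sum_(i <- r | P i) wedge (F i) b.
Proof. exact: (raddf_sum (wedger b)). Qed.

Lemma wedge_dzsl I b : wedge (dzs I) b =
  [ffun K : {set 'I_N} => if I \subset K
     then (-1) ^+ inversions I (K :\: I)%SET * b (K :\: I)%SET else 0].
Proof.
apply/ffunP => K; rewrite !ffunE; case: ifP => sIK.
  rewrite (bigD1 I) //= big1 => [|J /andP[_ /negPf neJ]].
    by rewrite ffunE eqxx mulr1 addr0.
  by rewrite ffunE neJ mulr0 mul0r.
rewrite big1 // => J sJK; rewrite ffunE.
case: eqP => [eJ|_]; last by rewrite mulr0 mul0r.
by rewrite -eJ sJK in sIK.
Qed.

Lemma wedge_dzs I J : [disjoint I & J] ->
  wedge (dzs I) (dzs J) = (-1) ^+ inversions I J *: dzs (I :|: J)%SET.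
Proof.
move=> dIJ; rewrite wedge_dzsl; apply/ffunP => K; rewrite !ffunE.
have [->|neK] := eqVneq K (I :|: J)%SET.
  rewrite finset.subsetUl finset.setDUl finset.setDv finset.set0U.
  by move: (dIJ); rewrite disjoint_sym => /finset.setDidPl->; rewrite eqxx.
rewrite [RHS]mulr0; case: ifP => // sIK; case: eqP => [eJ|]; last by rewrite mulr0.
by rewrite -(finset.setID K I) (finset.setIidPr sIK) eJ eqxx in neK.
Qed.

Lemma wedge1r a : wedge a (ext1 R N) = a.
Proof.
apply/ffunP => K; rewrite !ffunE (bigD1 K) //= big1 => [|I /andP[sIK neI]].
  by rewrite finset.setDv inversions0r ffunE eqxx expr0 mul1r mulr1 addr0.
rewrite ffunE finset.setD_eq0; case: (boolP (K \subset I)) => [sKI|_]; last by rewrite mulr0.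
by rewrite finset.eqEsubset sIK sKI in neI.
Qed.

Lemma homogeneous_wedge k l a b :
  homogeneous k a -> homogeneous l b -> homogeneous (k + l) (wedge a b).
Proof.
move=> ha hb K cK; rewrite ffunE big1 // => I sIK.
have [cI|cI] := eqVneq #|I| k; last by rewrite ha // mulr0 mul0r.
rewrite hb ?mulr0 //; apply: contra cK => /eqP cJ.
by rewrite -(cardsID I K) (finset.setIidPr sIK) cI cJ.
Qed.

End ExteriorTheory.

(** * Multiplication by a two-form dx /\ dy of consecutive indices *)

Lemma disjoint_setDl (T : finType) (A B : {set T}) : [disjoint (A :\: B)%SET & B].
Proof.
rewrite -finset.setI_eq0; apply/eqP/finset.setP => z.
by rewrite !inE; case: (z \in B); rewrite ?andbF.
Qed.

Section PairOperator.
Variables (R : realType) (N : nat) (x y : 'I_N).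
Implicit Types (a b : ext R N) (I J K : {set 'I_N}).

(* Exterior multiplication by [dz x /\ dz y] for consecutive indices [x], [y]:
   no sign appears. *)
Definition pair_mul a : ext R N :=
  [ffun K : {set 'I_N} =>
     if [set x; y]%SET \subset K then a (K :\: [set x; y])%SET else 0].

Lemma pair_mul_is_linear : linear pair_mul.
Proof.
move=> c b1 b2; apply/ffunP => K; rewrite !ffunE; case: ifP => _; rewrite ?ffunE //.
by rewrite scaler0 addr0.
Qed.
HB.instance Definition _ :=
  GRing.isLinear.Build R (ext R N) (ext R N) _ pair_mul pair_mul_is_linear.

Lemma pair_mul_sqr a : pair_mul (pair_mul a) = 0.
Proof.
apply/ffunP => K; rewrite !ffunE; case: ifP => // _; case: ifP => //.
by move/fintype.subsetP/(_ x); rewrite !inE eqxx => /(_ isT).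
Qed.

Lemma pair_mul_dzs K : [set x; y]%SET \subset K ->
  pair_mul (dzs R (K :\: [set x; y])%SET) = dzs R K.
Proof.
move=> sPK; apply/ffunP => J; rewrite !ffunE.
case: ifP => [sPJ|nsPJ].
  congr (_%:R); congr (nat_of_bool _); apply/eqP/eqP => [eD|->//].
  by rewrite -(finset.setID J [set x; y]%SET) eD (finset.setIidPr sPJ)
    -{1}(finset.setIidPr sPK) finset.setID.
by case: eqP => // eJ; rewrite eJ sPK in nsPJ.
Qed.

Lemma pair_mul_dzs0 K : ~~ [disjoint [set x; y]%SET & K] ->
  pair_mul (dzs R K) = 0.
Proof.
move=> nd; apply/ffunP => J; rewrite !ffunE; case: ifP => // sPJ.
case: eqP => // eJ; case/negP: nd; rewrite -eJ disjoint_sym.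
exact: disjoint_setDl.
Qed.

Hypothesis xy : y = x.+1 :> nat.

Let neq_xy : x != y.
Proof. by apply/eqP => e; move: xy; rewrite -e; lia. Qed.

(** An index other than the consecutive [x] and [y] lies on the same side of both, so inversions
    come in twos. *)
Lemma inversions_pair_r I : [disjoint I & [set x; y]%SET] ->
  odd (inversions I [set x; y]%SET) = false.
Proof.
move=> dI; rewrite inversionsE.
rewrite (eq_bigr (fun i : 'I_N => ((x < i) + (x < i))%N)) => [|i iI].
  by rewrite big_split /= addnn odd_double.
rewrite big_setU1 ?inE //= big_set1 xy; congr (_ + _)%N; rewrite [in RHS]leq_eqVlt.
case: eqP => // e; have : i \in [set x; y]%SET.
  by rewrite !inE (_ : i = y) ?eqxx ?orbT //; apply: val_inj; rewrite /= xy e.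
by rewrite (disjointFr dI iI).
Qed.

Lemma inversions_pair_l J : [disjoint [set x; y]%SET & J] ->
  odd (inversions [set x; y]%SET J) = false.
Proof.
move=> dJ; rewrite inversionsE big_setU1 ?inE //= big_set1.
rewrite [X in (_ + X)%N](eq_bigr (fun j : 'I_N => (j < x)%N : nat)) => [|j jJ].
  by rewrite addnn odd_double.
rewrite xy ltnS leq_eqVlt; case: eqP => // e.
have : j \in [set x; y]%SET by rewrite !inE (_ : j = x) ?eqxx //; apply: val_inj.
by rewrite (disjointFl dJ jJ).
Qed.

Lemma wedge_pairl a : wedge (dzs R [set x; y]%SET) a = pair_mul a.
Proof.
rewrite wedge_dzsl; apply/ffunP => K; rewrite !ffunE; case: ifP => // _.
rewrite -signr_odd inversions_pair_l ?mul1r //.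
by rewrite disjoint_sym disjoint_setDl.
Qed.

(** The pair has even degree: moving it past dz_I costs an even number of inversions, hence no
    sign. *)
Lemma wedge_pair_mulr a b : wedge a (pair_mul b) = pair_mul (wedge a b).
Proof.
apply/ffunP => K; rewrite !ffunE; set P := [set x; y]%SET.
(* Both sides sum over the same sets I: those inside K that leave the pair in K \ I are those inside
   K \ P. *)
have subD I : (I \subset K) && (P \subset K :\: I)%SET =
              (P \subset K) && (I \subset K :\: P)%SET.
  by rewrite !subsetD disjoint_sym andbCA.
case: ifP => [sPK|nsPK].
  rewrite big_mkcond [RHS]big_mkcond; apply: eq_bigr => I _.
  have := subD I; rewrite sPK /= => <-.
  case: ifP => //= sIK; rewrite ffunE -/P; case: ifP => [sPD|]; last by rewrite mulr0.
  rewrite !finset.setDDl [(P :|: I)%SET]finset.setUC.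
  congr (_ * _ * _).
  have dP : [disjoint (K :\: (I :|: P))%SET & P].
    by rewrite -finset.setDDl; exact: disjoint_setDl.
  rewrite -(finset.setID (K :\: I)%SET P) (finset.setIidPr sPD) finset.setDDl.
  rewrite inversionsUr; last by rewrite disjoint_sym.
  rewrite -signr_odd oddD inversions_pair_r ?signr_odd //.
  by move: sPD; rewrite subsetD disjoint_sym => /andP[].
rewrite big1 // => I sIK; rewrite ffunE -/P; have := subD I.
by rewrite sIK nsPK /= => ->; rewrite mulr0.
Qed.

End PairOperator.

Lemma pair_mul_comm (R : realType) (N : nat) (x y x' y' : 'I_N) (a : ext R N) :
  [disjoint [set x; y]%SET & [set x'; y']%SET] ->
  pair_mul x y (pair_mul x' y' a) = pair_mul x' y' (pair_mul x y a).
Proof.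
move=> d; apply/ffunP => K; rewrite !ffunE !subsetD d.
rewrite disjoint_sym d !andbT !finset.setDDl [X in (_ :\: X)%SET]finset.setUC.
by case: ifP; case: ifP.
Qed.

(** * Surjectivity of Lefschetz powers for commuting square-zero operators *)

Section GradedLefschetz.
Variables (F : numFieldType) (V : lmodType F) (I : Type).
Variables (E : I -> {linear V -> V}) (v : V).
Hypothesis EC : forall i j u, E i (E j u) = E j (E i u).
Hypothesis EE : forall i u, E i (E i u) = 0.
Implicit Types (T : seq I) (d : int) (u w : V).

Definition lefschetz T u : V := \sum_(j <- T) E j u.

Lemma lefschetz_is_linear T : linear (lefschetz T).
Proof.
move=> c u w; rewrite /lefschetz scaler_sumr -big_split /=.
by apply: eq_bigr => j _; rewrite linearP.
Qed.
HB.instance Definition _ T :=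
  GRing.isLinear.Build F V V _ (lefschetz T) (lefschetz_is_linear T).

Lemma lefschetz_cons j T u : lefschetz (j :: T) u = E j u + lefschetz T u.
Proof. by rewrite /lefschetz big_cons. Qed.

Lemma E_lefschetz j T u : E j (lefschetz T u) = lefschetz T (E j u).
Proof. by rewrite raddf_sum; apply: eq_bigr => i _; rewrite EC. Qed.

(* The span of the products [E j_1 (... (E j_d v))] over [d]-element
   subsequences of [T]; it is [0] for [d < 0] and for [d > size T]. *)
Fixpoint gspan T d u : Prop :=
  match T with
  | [::] => if d == 0 then exists c, u = c *: v else u = 0
  | j :: T' => exists2 u1, gspan T' d u1 &
               exists2 u2, gspan T' (d - 1) u2 & u = u1 + E j u2
  end.

Lemma gspanP T d c u w : gspan T d u -> gspan T d w -> gspan T d (c *: u + w).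
Proof.
elim: T d u w => [|j T IH] d u w /=.
  case: ifP => _; last by move=> -> ->; rewrite scaler0 addr0.
  by move=> [cu ->] [cw ->]; exists (c * cu + cw); rewrite scalerDl scalerA.
move=> [u1 hu1 [u2 hu2 ->]] [w1 hw1 [w2 hw2 ->]].
exists (c *: u1 + w1); first exact: IH.
exists (c *: u2 + w2); first exact: IH.
by rewrite linearP scalerDr addrACA.
Qed.

Lemma gspan0 T d : gspan T d 0.
Proof.
elim: T d => [|j T IH] d /=; first by case: ifP => // _; exists 0; rewrite scale0r.
by exists 0; [exact: IH | exists 0; [exact: IH | rewrite raddf0 addr0]].
Qed.

Lemma gspanZ T d c u : gspan T d u -> gspan T d (c *: u).
Proof. by move=> hu; rewrite -[c *: u]addr0; apply: gspanP (gspan0 _ _). Qed.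

Lemma gspanD T d u w : gspan T d u -> gspan T d w -> gspan T d (u + w).
Proof. by rewrite -{2}[u]scale1r; apply: gspanP. Qed.

Lemma gspanB T d u w : gspan T d u -> gspan T d w -> gspan T d (u - w).
Proof. by move=> hu hw; rewrite -scaleN1r; apply/gspanD/gspanZ. Qed.

(** With L the operator of the tail, (L + E_j)(u1 + E_j u2) = L u1 + E_j (u1 + L u2), since E_j has
    square zero. *)
Lemma gspan_lefschetz T d u : gspan T d u -> gspan T (d + 1) (lefschetz T u).
Proof.
elim: T d u => [|j T IH] d u /=.
  by move=> _; rewrite /lefschetz big_nil; exact: (gspan0 [::]).
move=> [u1 hu1 [u2 hu2 ->]]; exists (lefschetz T u1); first exact: IH.
exists (u1 + lefschetz T u2).
  by rewrite addrK; apply: gspanD => //; have := IH _ _ hu2; rewrite subrK.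
by rewrite lefschetz_cons !raddfD /= EE addr0 E_lefschetz addrCA addrA.
Qed.

Lemma gspan_iter_lefschetz T d m u :
  gspan T d u -> gspan T (d + m%:Z) (iter m (lefschetz T) u).
Proof.
move=> hu; elim: m => [|m IH] /=; first by rewrite addr0.
by rewrite -addn1 PoszD addrA; apply: gspan_lefschetz.
Qed.

Lemma iter_lefschetz_is_linear T m : linear (iter m (lefschetz T)).
Proof. by move=> c u w; elim: m => //= m ->; rewrite linearP. Qed.
HB.instance Definition _ T m :=
  GRing.isLinear.Build F V V _ (iter m (lefschetz T))
    (iter_lefschetz_is_linear T m).

(** The binomial formula stops after two terms because E_j has square zero: (L + E_j)^(m+1) =
    L^(m+1) + (m+1) E_j L^m. *)
Lemma iter_lefschetz_cons j T m u w :
  iter m.+1 (lefschetz (j :: T)) (u + E j w) =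
  iter m.+1 (lefschetz T) u +
  E j (m.+1%:R *: iter m (lefschetz T) u + iter m.+1 (lefschetz T) w).
Proof.
elim: m => [|m IH].
  rewrite [LHS]lefschetz_cons !linearD /= EE addr0 scale1r -E_lefschetz.
  by rewrite addrCA.
rewrite iterS IH lefschetz_cons !linearD /= !EE !addr0 -!E_lefschetz !linearZ /=.
rewrite addrCA; congr (_ + _); rewrite addrA; congr (_ + _).
by rewrite -[m.+2]addn1 natrD scalerDl scale1r addrC.
Qed.

Lemma lefschetz_onto T (b : int) m u :
  (size T)%:Z = b *+ 2 + m%:Z -> gspan T (b + m%:Z) u ->
  exists2 w, gspan T b w & iter m (lefschetz T) w = u.
Proof.
elim: T b m u => [|j T IH] b [|m] u.
- by move=> _; rewrite addr0 => hu; exists u.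
(* Here 2b + m + 1 = 0, so the degree b + m + 1 is (m + 1)/2, which is nonzero; the span of that
   degree is 0. *)
- move=> /= sz; rewrite ifF => [->|]; first by exists 0; rewrite ?raddf0 //; exact: (gspan0 [::]).
  by apply/negbTE; lia.
- by move=> _; rewrite addr0 => hu; exists u.
move=> sz [A hA [B hB ->]]; rewrite /= in sz.
(* Removing [j] leaves size 2b + m = 2(b - 1) + (m + 2): the induction hypothesis applies from
   degree b with power m and from degree b - 1 with power m + 2. *)
have sz1 : (size T)%:Z = (b - 1) *+ 2 + m.+2%:Z by lia.
have deg1 : b - 1 + m.+2%:Z = b + m.+1%:Z by lia.
have [|a ha Ea] := IH (b - 1) m.+2 A sz1; first by rewrite deg1.
have [||w hw Ew] := IH b m B; first by lia.
  by rewrite (_ : b + m%:Z = b + m.+1%:Z - 1) //; lia.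
(* The element [c] corrects [w]: L^(m+1) kills w - L c. *)
have [|c hc Ec] := IH (b - 1) m.+2 (iter m.+1 (lefschetz T) w) sz1.
  by rewrite deg1; exact: gspan_iter_lefschetz.
have up z : gspan T (b - 1) z -> gspan T b (lefschetz T z).
  by move=> /gspan_lefschetz; rewrite subrK.
have m0 : m.+1%:R != 0 :> F by rewrite pnatr_eq0.
pose u1 := m.+1%:R^-1 *: (w - lefschetz T c) + lefschetz T a.
pose u2 := c - m.+1%:R *: a.
exists (u1 + E j u2).
  exists u1; first by apply: gspanD (up _ ha); apply/gspanZ/gspanB => //; exact: up.
  by exists u2 => //; apply: gspanB => //; apply: gspanZ.
have LD k x y : iter k (lefschetz T) (x + y) =
  iter k (lefschetz T) x + iter k (lefschetz T) y by exact: linearD.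
have LB k x y : iter k (lefschetz T) (x - y) =
  iter k (lefschetz T) x - iter k (lefschetz T) y by exact: linearB.
have LZ k e x : iter k (lefschetz T) (e *: x) = e *: iter k (lefschetz T) x.
  exact: linearZ.
rewrite iter_lefschetz_cons; congr (_ + E j _).
  (* The first component reduces to L^(m+2) a = A. In the second, the terms in [a] and in [c] cancel
     and L^m w = B remains. *)
  by rewrite /u1 LD LZ LB -!iterSr Ec Ea subrr scaler0 add0r.
rewrite /u1 /u2 (LD m) (LB m.+1) !LZ (LB m) -!iterSr Ew scalerDr scalerA divff // scale1r.
by rewrite addrA addrAC addrK subrK.
Qed.

End GradedLefschetz.

(** * The coordinates x_j, y_j, t and their pairs *)

Section ContactCoordinates.
Variable n : nat.
Implicit Types (i j : 'I_n) (K : {set 'I_(2 * n).+1}).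

Lemma val_xc j : xc j = (2 * j)%N :> nat.
Proof. by rewrite inordK //; have := ltn_ord j; lia. Qed.

Lemma val_yc j : yc j = (2 * j).+1 :> nat.
Proof. by rewrite inordK //; have := ltn_ord j; lia. Qed.

Lemma xc_inj : injective (@xc n).
Proof. by move=> i j /(congr1 val) /=; rewrite !val_xc => e; apply: val_inj => /=; lia. Qed.

Lemma yc_inj : injective (@yc n).
Proof. by move=> i j /(congr1 val) /=; rewrite !val_yc => e; apply: val_inj => /=; lia. Qed.

Lemma xc_neq_yc i j : (xc i == yc j) = false.
Proof. by apply/eqP => /(congr1 val) /=; rewrite val_xc val_yc; lia. Qed.

Lemma xc_neq_tc j : (xc j == tc n) = false.
Proof. by apply/eqP => /(congr1 val) /=; rewrite val_xc; have := ltn_ord j; lia. Qed.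

Lemma yc_neq_tc j : (yc j == tc n) = false.
Proof. by apply/eqP => /(congr1 val) /=; rewrite val_yc; have := ltn_ord j; lia. Qed.

Variant coord_spec : 'I_(2 * n).+1 -> Type :=
  | CoordX j : coord_spec (xc j)
  | CoordY j : coord_spec (yc j)
  | CoordT : coord_spec (tc n).

Lemma coordP k : coord_spec k.
Proof.
have [kn|nk] := ltnP k (2 * n); last first.
  rewrite (_ : k = tc n); first exact: CoordT.
  by apply: val_inj => /=; have := ltn_ord k; lia.
have h : (k./2 < n)%N by lia.
case: (boolP (odd k)) => ok.
  rewrite (_ : k = yc (Ordinal h)); first exact: CoordY.
  by apply: val_inj; rewrite /= val_yc /=; lia.
rewrite (_ : k = xc (Ordinal h)); first exact: CoordX.
by apply: val_inj; rewrite /= val_xc /=; lia.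
Qed.

Definition xy_pair j : {set 'I_(2 * n).+1} := [set xc j; yc j]%SET.

Lemma card_xy_pair j : #|xy_pair j| = 2%N.
Proof. by rewrite cards2 xc_neq_yc. Qed.

Lemma tc_xy_pair j : (tc n \in xy_pair j) = false.
Proof. by rewrite !inE ![tc n == _]eq_sym xc_neq_tc yc_neq_tc. Qed.

Lemma disjoint_xy_pair i j : i != j -> [disjoint xy_pair i & xy_pair j].
Proof.
move=> /negPf ij; rewrite -finset.setI_eq0; apply/eqP/finset.setP => k; rewrite !inE.
case: (coordP k) => [l|l|].
- rewrite !xc_neq_yc !orbF !(inj_eq xc_inj).
  by apply/andP => -[/eqP->]; rewrite ij.
- rewrite ![yc l == xc _]eq_sym !xc_neq_yc /= !(inj_eq yc_inj).
  by apply/andP => -[/eqP->]; rewrite ij.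
by rewrite ![tc n == _]eq_sym !xc_neq_tc !yc_neq_tc.
Qed.

(** Drop the last index and group the others as 2j, 2j + 1, which are [xc j] and [yc j]. *)
Lemma card_without_tc K : tc n \notin K ->
  #|K| = (\sum_(j < n) ((xc j \in K) + (yc j \in K)))%N.
Proof.
move=> tK; rewrite -sum1_card big_mkcond big_ord_recr /= (negPf tK) addn0.
have dbl (F : nat -> nat) l :
    (\sum_(i < 2 * l) F i = \sum_(j < l) (F (2 * j) + F (2 * j).+1))%N.
  elim: l => [|l IH]; first by rewrite muln0 !big_ord0.
  by rewrite mulnS !add2n !big_ord_recr /= IH addnA.
rewrite -(dbl (fun k => inord k \in K : nat)); apply: eq_bigr => i _.
rewrite (_ : widen_ord _ i = inord i); first by case: ifP.
by apply: val_inj => /=; rewrite inordK // ltnS ltnW.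
Qed.

End ContactCoordinates.

(** * Inverting the Lefschetz power on horizontal monomials *)

Section ContactLefschetz.
Variables (R : realType) (n : nat).
Local Notation N := (2 * n).+1.
Implicit Types (a u : ext R N) (J K : {set 'I_N}) (B : seq 'I_n).

Definition xy_mul (j : 'I_n) : {linear ext R N -> ext R N} :=
  @pair_mul R N (xc j) (yc j).

Lemma xy_mulC i j a : xy_mul i (xy_mul j a) = xy_mul j (xy_mul i a).
Proof.
have [->//|ij] := eqVneq i j.
exact/pair_mul_comm/disjoint_xy_pair.
Qed.

Lemma xy_mul_sqr j a : xy_mul j (xy_mul j a) = 0.
Proof. exact: pair_mul_sqr. Qed.

(** When [B] lists the full pairs of K, what remains is the set of singles. Removing the head pair
    first matches the outermost operator of [foldr xy_mul]. *)
Definition setDpairs K B := foldl (fun K j => K :\: xy_pair j)%SET K B.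

Lemma in_setDpairs K B k :
  (k \in setDpairs K B) = (k \in K) && all (fun j => k \notin xy_pair j) B.
Proof.
elim: B K => [|j B IH] K /=; first by rewrite andbT.
by rewrite IH finset.in_setD andbA; congr (_ && _); rewrite andbC.
Qed.

Lemma sub_setD_pair i j K : i != j -> xy_pair i \subset K ->
  xy_pair i \subset (K :\: xy_pair j)%SET.
Proof. by move=> ij siK; rewrite subsetD siK disjoint_xy_pair. Qed.

Lemma foldr_xy_mul K B : uniq B -> all (fun j => xy_pair j \subset K) B ->
  foldr xy_mul (dzs R (setDpairs K B)) B = dzs R K.
Proof.
elim: B K => [|j B IH] K //= /andP[jB uB] /andP[sjK /allP sBK].
rewrite IH //; first exact: pair_mul_dzs.
apply/allP => i iB; apply: sub_setD_pair (sBK i iB).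
by apply: contraNneq jB => <-.
Qed.

Lemma card_setDpairs K B : uniq B -> all (fun j => xy_pair j \subset K) B ->
  (#|setDpairs K B| + 2 * size B)%N = #|K|.
Proof.
elim: B K => [|j B IH] K /=; first by rewrite muln0 addn0.
move=> /andP[jB uB] /andP[sjK /allP sBK].
rewrite mulnS addnCA IH //.
  by rewrite -(cardsID (xy_pair j) K) (finset.setIidPr sjK) card_xy_pair.
apply/allP => i iB; apply: sub_setD_pair (sBK i iB).
by apply: contraNneq jB => <-.
Qed.

(** Places a monomial, factored into its full pairs and its singles, in a span to which
    [lefschetz_onto] applies. *)
Lemma gspan_foldr (P : pred 'I_n) (T : seq 'I_n) u :
  gspan xy_mul u T (size [seq j <- T | P j])%:Z (foldr xy_mul u [seq j <- T | P j]).
Proof.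
elim: T => [|j T IH] /=; first by exists 1; rewrite scale1r.
case: ifP => Pj /=; last first.
  by exists (foldr xy_mul u [seq j <- T | P j]) => //; exists 0; rewrite ?raddf0 ?addr0 //; exact: gspan0.
exists 0; first exact: gspan0.
exists (foldr xy_mul u [seq j <- T | P j]); last by rewrite add0r.
by rewrite (_ : _ - 1 = (size [seq j <- T | P j])%:Z) //; lia.
Qed.

(** Each pair operator adds two indices and never t. This makes the preimages below horizontal and
    homogeneous. *)
Lemma gspan_support (S J : {set 'I_N}) (T : seq 'I_n) (d : int) u : tc n \notin S ->
  gspan xy_mul (dzs R S) T d u ->
  u J = 0 \/ tc n \notin J /\ #|J|%:Z = #|S|%:Z + d *+ 2.
Proof.
move=> tS; elim: T d u J => [|j T IH] d u J /=.
  case: eqP => [->|_ ->]; last by left; rewrite ffunE.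
  move=> [c ->]; rewrite !ffunE; case: eqP => [->|_]; first by right; split; rewrite // addr0.
  by left; rewrite /GRing.scale /= mulr0.
move=> [u1 hu1 [u2 hu2 ->]]; rewrite ffunE.
have [->|?] := IH _ _ J hu1; last by right.
rewrite ffunE add0r; case: ifP => sJ; last by left.
have [->|[tJ cJ]] := IH _ _ (J :\: xy_pair j)%SET hu2; first by left.
right; split.
  by apply: contra tJ => tJ; rewrite finset.in_setD tc_xy_pair.
rewrite -(cardsID (xy_pair j) J) (finset.setIidPr sJ) card_xy_pair PoszD cJ.
by move: #|S|%:Z => s; lia.
Qed.

(** E_j commutes through each product until it reaches [v]. *)
Lemma xy_mul_gspan0 v (T : seq 'I_n) (d : int) j u : xy_mul j v = 0 ->
  gspan xy_mul v T d u -> xy_mul j u = 0.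
Proof.
move=> jv; elim: T d u => [|i T IH] d u /=.
  case: ifP => _; last by move=> ->; rewrite raddf0.
  by move=> [c ->]; rewrite linearZ /= jv scaler0.
move=> [u1 hu1 [u2 hu2 ->]].
by rewrite linearD /= (IH _ _ hu1) xy_mulC (IH _ _ hu2) raddf0 addr0.
Qed.

Definition contact_lefschetz : ext R N -> ext R N :=
  lefschetz xy_mul (index_enum 'I_n).

(** With s singles, |B| full pairs and |T| pairs that are full or empty, n = s + |T| and n + m = s +
    2|B|. Hence |T| = 2(|B| - m) + m, the balance required by [lefschetz_onto]. *)
Lemma contact_lefschetz_onto K (m : nat) : tc n \notin K -> #|K| = (n + m)%N ->
  exists g : ext R N,
    [/\ forall J, tc n \in J -> g J = 0,
        forall l, (l + m = n)%N -> homogeneous l g &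
        iter m contact_lefschetz g = dzs R K].
Proof.
move=> tK cK.
pose free j := (xc j \in K) == (yc j \in K).
pose full j := xy_pair j \subset K.
have fullE j : full j = (xc j \in K) && (yc j \in K).
  by rewrite /full finset.subUset !finset.sub1set.
pose T := [seq j <- index_enum 'I_n | free j].
pose B := [seq j <- T | full j].
have sT : size T = (\sum_(j < n) free j)%N by rewrite size_filter -sum1_count big_mkcond.
have sB : size B = (\sum_(j < n) full j)%N.
  rewrite size_filter count_filter -sum1_count big_mkcond /=.
  apply: eq_bigr => j _; rewrite /= fullE /free.
  by case: (xc j \in K); case: (yc j \in K).
(* Per index j: 2 + 1 = 1 + 2 for a full pair, 0 + 1 = 1 + 0 for an empty one, 0 + 1 = 0 + 1 + 0
   terms-wise for a single. *)
have count_eq : (2 * size B + n = size T + #|K|)%N.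
  rewrite sT sB card_without_tc // -[X in (_ + X)%N]card_ord -sum1_card.
  rewrite big_distrr -!big_split; apply: eq_bigr => j _ /=; rewrite fullE /free.
  by case: (xc j \in K); case: (yc j \in K).
rewrite cK in count_eq.
have uT : uniq T by rewrite filter_uniq // index_enum_uniq.
have uB : uniq B by rewrite filter_uniq.
have aB : all full B by apply: filter_all.
pose S := setDpairs K B.
have tS : tc n \notin S by rewrite in_setDpairs (negPf tK).
have cS := card_setDpairs uB aB; rewrite -/S cK in cS.
(* If [j] is not free, one index of its pair lies in K and survives in S, since the removed pairs
   are disjoint from it; E_j would repeat that index. *)
have kill j : ~~ free j -> xy_mul j (dzs R S) = 0.
  move=> nfj; apply: pair_mul_dzs0; rewrite -finset.setI_eq0.
  have inS k : k \in xy_pair j -> k \in K -> k \in S.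
    move=> kj kK; rewrite in_setDpairs kK; apply/allP => i; rewrite mem_filter => /andP[fi _].
    have ij : j != i.
      apply: contraNneq nfj => ->; move: fi; rewrite fullE /free.
      by case: (xc i \in K); case: (yc i \in K).
    by rewrite (disjointFr (disjoint_xy_pair ij) kj).
  apply/finset.set0Pn; move: nfj; rewrite /free; case: (boolP (xc j \in K)) => xK.
    by move=> _; exists (xc j); rewrite finset.in_setI inS ?andbT // !inE eqxx.
  case: (boolP (yc j \in K)) => // yK _.
  by exists (yc j); rewrite finset.in_setI inS ?andbT // !inE eqxx orbT.
have sTB : (size T)%:Z = ((size B)%:Z - m%:Z) *+ 2 + m%:Z.
  move: count_eq; move: (size T) (size B) => t b; lia.
have [|w hw Ew] := @lefschetz_onto _ _ _ xy_mul (dzs R S) xy_mulC xy_mul_sqr T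
    ((size B)%:Z - m%:Z) m (dzs R K) sTB.
  by rewrite subrK -(foldr_xy_mul uB aB); exact: gspan_foldr.
(* On this span the full Lefschetz operator agrees with the one over T, as the remaining E_j vanish
   there. *)
have LT (d : int) u : gspan xy_mul (dzs R S) T d u ->
    contact_lefschetz u = lefschetz xy_mul T u.
  move=> hu; rewrite /contact_lefschetz /lefschetz big_filter.
  rewrite (bigID free) /= [X in _ + X]big1 ?addr0 // => j /kill kj.
  exact: xy_mul_gspan0 kj hu.
exists w; split.
- move=> J tJ; have [//|[]] := gspan_support J tS hw.
  by rewrite tJ.
(* The degree is |S| + 2(|B| - m) = (n + m) - 2m = n - m. *)
- move=> l lm J cJ; have [//|[_ eJ]] := gspan_support J tS hw.
  by case/eqP: cJ; move: eJ cS count_eq; move: #|S| #|J| => s k; lia.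
rewrite -Ew; elim: {1 2}m => //= l ->.
by rewrite (LT _ _ (gspan_iter_lefschetz xy_mulC xy_mul_sqr l hw)).
Qed.

End ContactLefschetz.

Local Open Scope classical_set_scope.

(** * Closure properties of smooth functions *)

Section SmoothTheory.
Variables (R : realType) (N : nat).
Implicit Types f g : 'rV[R]_N -> R.

Lemma is_derive_affine f (p v : 'rV[R]_N) (c : R) :
  (forall h : R, f (h *: v + p) = h * c + f p) -> is_derive p v f c.
Proof.
move=> fE.
have cv : (fun h : R => h^-1 *: ((f \o shift p) (h *: v) - f p)) @ 0^' --> c.
  apply: cvg_near_cst; near=> h.
  by rewrite /= fE addrK scalerA mulVf ?scale1r //; near: h; exact: nbhs_dnbhs_neq.
by split; [apply/cvg_ex; exists c|exact: cvg_lim cv].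
Unshelve. all: by end_near. Qed.

Lemma smooth_foldr f s : smooth f -> smooth (foldr (@partial_derivative R N) f s).
Proof. by move=> sf s'; rewrite -foldr_cat; apply: sf. Qed.

Lemma smooth_continuous f : smooth f -> continuous f.
Proof. by move=> /(_ [::])[]. Qed.

Lemma smooth_derivable f p i : smooth f -> derivable f p (delta_mx 0 i).
Proof. by move=> /(_ [::])[_]; apply. Qed.

Lemma smooth_cst (c : R) : smooth (fun _ : 'rV[R]_N => c).
Proof.
have E s : exists c', foldr (@partial_derivative R N) (fun=> c) s = (fun=> c').
  elim: s => [|i s [c' IH]] /=; first by exists c.
  by exists 0; apply/funext => p; rewrite IH /partial_derivative derive_cst -?IH.
move=> s; have [c' ->] := E s; split; first exact: cst_continuous.
by move=> p i; exact: derivable_cst.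
Qed.

Lemma foldr_partial_derivativeD f g s : smooth f -> smooth g ->
  foldr (@partial_derivative R N) (f \+ g) s =
  foldr (@partial_derivative R N) f s \+ foldr (@partial_derivative R N) g s.
Proof.
move=> sf sg; elim: s => //= i s ->; apply/funext => p.
by rewrite /partial_derivative deriveD //; apply: smooth_derivable;
  apply: smooth_foldr.
Qed.

Lemma smoothD f g : smooth f -> smooth g -> smooth (f \+ g).
Proof.
move=> sf sg s; rewrite foldr_partial_derivativeD //.
have [cf df] := sf s; have [cg dg] := sg s.
split; first by move=> p; exact: cvgD (cf p) (cg p).
by move=> p i; exact: derivableD (df p i) (dg p i).
Qed.

Lemma smooth_sum T (r : seq T) (P : pred T) (f : T -> 'rV[R]_N -> R) :
  (forall i, P i -> smooth (f i)) -> smooth (fun p => \sum_(i <- r | P i) f i p).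
Proof.
move=> sf; elim: r => [|i r IH].
  rewrite (_ : (fun p => _) = fun=> 0); first exact: smooth_cst.
  by apply/funext => p; rewrite big_nil.
case Pi : (P i); last first.
  by rewrite (_ : (fun p => _) = fun p => \sum_(j <- r | P j) f j p) //;
    apply/funext => p; rewrite big_cons Pi.
rewrite (_ : (fun p => _) = f i \+ fun p => \sum_(j <- r | P j) f j p).
  exact: smoothD (sf i Pi) IH.
by apply/funext => p; rewrite big_cons Pi.
Qed.

Lemma is_derive_coord (p : 'rV[R]_N) i j :
  is_derive p (delta_mx 0 j) (fun q => q 0 i : R) (i == j)%:R.
Proof. by apply: is_derive_affine => h; rewrite !mxE eqxx. Qed.

(** By induction on [s], the iterated derivative of z_i f is z_i times that of f plus a smooth
    remainder [g]. *)
Lemma smooth_coordM i f : smooth f -> smooth (fun p => p 0 i * f p).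
Proof.
move=> sf.
have E s : exists2 g, smooth g &
    foldr (@partial_derivative R N) (fun p => p 0 i * f p) s =
    (fun p => p 0 i * foldr (@partial_derivative R N) f s p + g p).
  elim: s => [|j s [g sg IH]] /=.
    exists (fun=> 0); first exact: smooth_cst.
    by apply/funext => p; rewrite addr0.
  have sF := smooth_foldr s sf; set F := foldr _ f s in IH sF *.
  (* The Leibniz term in which z_i is differentiated; it joins the remainder. *)
  pose h := if i == j then F else fun=> 0.
  exists (h \+ partial_derivative j g).
    apply: smoothD; last exact: (smooth_foldr [:: j] sg).
    by rewrite /h; case: ifP => // _; exact: smooth_cst.
  apply/funext => p; rewrite IH.
  have dF := @smooth_derivable F p j sF; have dg := @smooth_derivable g p j sg.
  have dc := is_derive_coord p i j.
  rewrite /partial_derivative.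
  rewrite (@deriveD _ _ _ (fun q : 'rV[R]_N => q 0 i * F q) g) //; last exact: derivableM.
  rewrite (@deriveM _ _ (fun q : 'rV[R]_N => q 0 i : R) F) // derive_val.
  rewrite /h /= addrA; congr (_ + _); congr (_ + _).
  by case: eqP => _; rewrite /GRing.scale /= ?mulr1 ?mulr0.
move=> s; have [g sg ->] := E s; have [cF dF] := sf s; split.
  move=> p; have := @continuousM R 'rV[R]_N (fun q => q 0 i) _ p
    (@coord_continuous _ _ _ _ _ p) (cF p).
  by move=> /continuousD; apply; exact: smooth_continuous.
move=> p j; apply: derivableD; last exact: smooth_derivable.
by apply: derivableM => //; have [] := is_derive_coord p i j.
Qed.

Lemma smoothZ (c : R) f : smooth f -> smooth (fun p => c * f p).
Proof.
move=> sf.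
have E s : foldr (@partial_derivative R N) (fun p => c * f p) s =
    (fun p => c * foldr (@partial_derivative R N) f s p).
  elim: s => //= i s ->; apply/funext => p; rewrite /partial_derivative.
  by apply: deriveZ; apply/smooth_derivable/smooth_foldr.
move=> s; rewrite E; have [cF dF] := sf s; split.
  by move=> p; apply: (@continuousM R 'rV[R]_N (cst c) _ p _ (cF p)); exact: cst_continuous.
by move=> p i; exact: derivableZ.
Qed.

End SmoothTheory.

(** * Vanishing t-coefficients and spans of dx_I /\ dy_J *)

Section WithoutDt.
Variables (R : realType) (n : nat).
Local Notation N := (2 * n).+1.

(** Factors with distinct indices multiply to a monomial up to sign; [c] is built as the product of
    the reordering signs. *)
Lemma big_wedge_dz (h : 'I_n -> 'I_N) (I : {set 'I_n}) (s : seq 'I_n) :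
  injective h -> uniq s ->
  exists c : R, c *: \big[@wedge R N/ext1 R N]_(j <- s | j \in I) dz R (h j) =
    dzs R [set:: [seq h j | j <- s & j \in I]]%SET.
Proof.
move=> hI; elim: s => [|j s IH] /=.
  by exists 1; rewrite big_nil scale1r; apply/ffunP => K; rewrite !ffunE.
move=> /andP[js us]; have [c cE] := IH us; rewrite big_cons.
case: ifP => jI; last by exists c.
set H := [set:: _]%SET in cE.
have dH : [disjoint [set h j]%SET & H]%B.
  rewrite disjoints1 inE; apply: contra js => /mapP[i].
  by rewrite mem_filter => /andP[_ si] /hI ->.
exists ((-1) ^+ inversions [set h j]%SET H * c).
rewrite -scalerA -wedgeZr cE.
rewrite (wedge_dzs R dH) scalerA -expr2 sqrr_sign scale1r.
by rewrite finset.set_cons.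
Qed.

Definition xy_set (IJ : {set 'I_n} * {set 'I_n}) : {set 'I_N} :=
  (@xc n @: IJ.1 :|: @yc n @: IJ.2)%SET.

Lemma wedge_dx_dy (IJ : {set 'I_n} * {set 'I_n}) :
  exists c : R, c *: wedge (dx_ R IJ.1) (dy_ R IJ.2) = dzs R (xy_set IJ).
Proof.
have [c cE] := big_wedge_dz IJ.1 (@xc_inj n) (index_enum_uniq 'I_n).
have [d dE] := big_wedge_dz IJ.2 (@yc_inj n) (index_enum_uniq 'I_n).
have im (h : 'I_n -> 'I_N) (I : {set 'I_n}) :
    [set:: [seq h j | j <- index_enum 'I_n & j \in I]]%SET = (h @: I)%SET.
  apply/finset.setP => i; rewrite inE; apply/mapP/imsetP => -[j].
    by rewrite mem_filter => /andP[jI _] ->; exists j.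
  by move=> jI ->; exists j; rewrite // mem_filter jI mem_index_enum.
rewrite im in cE; rewrite im in dE.
have dxy : [disjoint (@xc n @: IJ.1)%SET & (@yc n @: IJ.2)%SET]%B.
  rewrite -finset.setI_eq0; apply/eqP/finset.setP => k; rewrite !inE.
  apply/negbTE/negP => /andP[/imsetP[i _ ->] /imsetP[j _ /eqP]].
  by rewrite xc_neq_yc.
exists ((-1) ^+ inversions (@xc n @: IJ.1)%SET (@yc n @: IJ.2)%SET * (c * d)).
rewrite -2!scalerA -wedgeZr -wedgeZl.
by rewrite [X in wedge X]cE [X in wedge _ X]dE (wedge_dzs R dxy) scalerA -expr2 sqrr_sign scale1r.
Qed.

(** The pairs (I, J) biject with the index sets avoiding t, and dx_I /\ dy_J is the corresponding
    monomial up to a scalar. *)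
Lemma without_dtP (w : diff_form R N) :
  (forall p (K : {set 'I_N}), tc n \in K -> w p K = 0) -> without_dt w.
Proof.
move=> w0 p; have [c cE] := choice wedge_dx_dy.
exists (fun I J => w p (xy_set (I, J)) * c (I, J)).
(* The inverse of [xy_set] on sets avoiding t. *)
pose yx (K : {set 'I_N}) : {set 'I_n} * {set 'I_n} := (@xc n @^-1: K, @yc n @^-1: K)%SET.
rewrite pair_bigA /= [LHS]ext_sum_dzs (bigID (fun K : {set 'I_N} => tc n \notin K)) /=.
rewrite [X in _ + X]big1 ?addr0 => [|K]; last first.
  by rewrite negbK => tK; rewrite w0 // scale0r.
rewrite (reindex_onto xy_set yx) /= => [|K tK]; last first.
  apply/finset.setP => k; rewrite !inE; case: (coordP k) tK => [j|j|] tK.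
  - rewrite mem_imset ?inE; last exact: xc_inj.
    rewrite orb_idr // => /imsetP[i _ /eqP]; by rewrite xc_neq_yc.
  - rewrite [X in _ || X]mem_imset ?inE; last exact: yc_inj.
    rewrite orb_idl // => /imsetP[i _ /eqP]; by rewrite eq_sym xc_neq_yc.
  rewrite (negPf tK); apply/negbTE/negP => /orP[] /imsetP[j _ /eqP].
    by rewrite eq_sym xc_neq_tc.
  by rewrite eq_sym yc_neq_tc.
apply: eq_big => [[I J]|[I J] _] /=; last by rewrite -cE scalerA.
apply/andP; split.
  rewrite !inE; apply/negP => /orP[] /imsetP[j _ /eqP].
    by rewrite eq_sym xc_neq_tc.
  by rewrite eq_sym yc_neq_tc.
apply/eqP; congr pair; apply/finset.setP => j; rewrite !inE.
  rewrite mem_imset; last exact: xc_inj.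
  rewrite orb_idr // => /imsetP[i _ /eqP]; by rewrite xc_neq_yc.
rewrite [X in _ || X]mem_imset; last exact: yc_inj.
rewrite orb_idl // => /imsetP[i _ /eqP]; by rewrite eq_sym xc_neq_yc.
Qed.

End WithoutDt.

(** * The contact form, its differential and the powers of the latter *)

Section ContactForm.
Variables (R : realType) (n : nat).
Local Notation N := (2 * n).+1.
Local Notation alpha := (contact_form R n).
Implicit Types (p : 'rV[R]_N) (K : {set 'I_N}).

Lemma contact_formE p K : alpha p K = dz R (tc n) K + 2 * \sum_(j < n)
  (p ord0 (xc j) * dz R (yc j) K - p ord0 (yc j) * dz R (xc j) K).
Proof.
rewrite /contact_form ffunE; congr (_ + _); rewrite ffunE sum_ffunE; congr (_ * _).
by apply: eq_bigr => j _; rewrite !ffunE.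
Qed.

Lemma contact_form_homogeneous p : homogeneous 1 (alpha p).
Proof.
have dz0 i K : #|K| != 1 -> dz R i K = 0 :> R.
  by move=> cK; rewrite ffunE; case: eqP => // eK; rewrite eK cards1 in cK.
move=> K cK; rewrite contact_formE dz0 // big1 ?mulr0 ?addr0 // => j _.
by rewrite !dz0 // !mulr0 subrr.
Qed.

Lemma contact_form_tc p K : tc n \in K -> alpha p K = (K == [set tc n]%SET)%:R.
Proof.
move=> tK; rewrite contact_formE ffunE big1 ?mulr0 ?addr0 // => j _.
have dz0 i : i == tc n = false -> dz R i K = 0 :> R.
  move=> it; rewrite ffunE; case: eqP => // eK.
  by move: tK; rewrite eK inE eq_sym it.
by rewrite !dz0 ?xc_neq_tc ?yc_neq_tc // !mulr0 subrr.
Qed.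

(** The coefficients of alpha are affine in the coordinates, so the product is a linear combination
    of f and of the z_i f. *)
Lemma smooth_mul_contact_form (f : 'rV[R]_N -> R) K :
  smooth f -> smooth (fun p => f p * alpha p K).
Proof.
move=> sf; have -> : (fun p => f p * alpha p K) = (fun p => dz R (tc n) K * f p) \+
    (fun p => \sum_(j < n) ((2 * dz R (yc j) K) * (p ord0 (xc j) * f p)
                         + (- (2 * dz R (xc j) K)) * (p ord0 (yc j) * f p))).
  apply/funext => p /=; rewrite contact_formE mulrDr mulrC; congr (_ + _).
  rewrite !mulr_sumr; apply: eq_bigr => j _; ring.
apply: smoothD; first exact: smoothZ.
apply: smooth_sum => j _.
by apply: smoothD; apply: smoothZ; apply: smooth_coordM.
Qed.

Lemma partial_contact_form p K i :
  partial_derivative i (fun q => alpha q K) p =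
  2 * \sum_(j < n) ((xc j == i)%:R * dz R (yc j) K - (yc j == i)%:R * dz R (xc j) K).
Proof.
rewrite /partial_derivative.
apply: (@derive_val _ _ _ _ _ _ _ (is_derive_affine _)) => h.
rewrite !contact_formE mulrCA addrCA -mulrDr; congr (_ + _ * _).
rewrite mulr_sumr -big_split; apply: eq_bigr => j _ /=.
rewrite !mxE !eqxx /=; ring.
Qed.

(** Each j contributes 2 (dx_j /\ dy_j - dy_j /\ dx_j), which is 4 dx_j /\ dy_j. *)
Lemma ext_d_contact_form p :
  ext_d alpha p = 4 *: \sum_(j < n) dzs R (xy_pair j).
Proof.
rewrite /ext_d.
transitivity (\sum_(i < N) \sum_(j < n)
   2 *: ((xc j == i)%:R *: wedge (dz R (xc j)) (dz R (yc j))
      - (yc j == i)%:R *: wedge (dz R (yc j)) (dz R (xc j)))).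
  apply: eq_bigr => i _.
  rewrite (_ : [ffun K => _] = \sum_(j < n) 2 *: ((xc j == i)%:R *: dz R (yc j)
      - (yc j == i)%:R *: dz R (xc j))).
    rewrite raddf_sum /=; apply: eq_bigr => j _.
    rewrite wedgeZr raddfB /= !wedgeZr; congr (_ *: _); congr (_ - _).
      by case: eqP => [->|_]; rewrite ?scale0r.
    by case: eqP => [->|_]; rewrite ?scale0r.
  apply/ffunP => K; rewrite ffunE partial_contact_form sum_ffunE mulr_sumr.
  by apply: eq_bigr => j _; rewrite !ffunE.
rewrite exchange_big scaler_sumr; apply: eq_bigr => j _ /=.
rewrite -scaler_sumr sumrB -!scaler_suml.
have s1 (k : 'I_N) : \sum_(i < N) (k == i)%:R = 1 :> R.
  by rewrite (bigD1 k) //= eqxx big1 ?addr0 // => i /negPf; rewrite eq_sym => ->.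
rewrite !s1 !scale1r.
have dxy : [disjoint [set xc j]%SET & [set yc j]%SET]%B.
  by rewrite disjoints1 inE xc_neq_yc.
have inv1 (a b : 'I_N) : inversions [set a]%SET [set b]%SET = (b < a)%N.
  by rewrite inversionsE !big_set1.
rewrite [wedge _ _](wedge_dzs R dxy) [X in _ - X](wedge_dzs R _); last by rewrite disjoint_sym.
(* There is no inversion in the order x_j, y_j and one in the order y_j, x_j. *)
rewrite !inv1 val_xc val_yc ltnS leqnn ltnNge leqnSn /= expr0 expr1.
rewrite scale1r scaleN1r opprK [([set yc j] :|: _)%SET]finset.setUC -/(xy_pair j).
by rewrite -mulr2n -[dzs R _ *+ 2]scaler_nat scalerA -natrM.
Qed.

(** The two-forms are moved to the left of [a] one at a time; each is 4 times the Lefschetz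
    operator. *)
Lemma wedge_pow_contact (a : ext R N) p m :
  wedge a (wedge_pow (ext_d alpha p) m) = 4 ^+ m *: iter m (@contact_lefschetz R n) a.
Proof.
have Lr b : wedge (ext_d alpha p) b = 4 *: contact_lefschetz b.
  rewrite ext_d_contact_form wedgeZl wedge_suml; congr (_ *: _).
  by apply: eq_bigr => j _; apply: wedge_pairl; rewrite val_xc val_yc.
elim: m => [|m IH]; first by rewrite wedge1r scale1r.
rewrite /wedge_pow iterS -/(wedge_pow _ m) Lr linearZ /= exprS -scalerA; congr (_ *: _).
rewrite -[RHS]linearZ -IH raddf_sum; apply: eq_bigr => j _.
by apply: wedge_pair_mulr; rewrite val_xc val_yc.
Qed.

End ContactForm.

(** * Extracting the coefficient of dt *)

Section HorizontalPart.
Variables (R : realType) (n : nat).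
Local Notation N := (2 * n).+1.
Local Notation alpha := (contact_form R n).
Implicit Types (a : ext R N) (K : {set 'I_N}).

(* The coefficient of [dt] in [a]; no sign appears since [t] is the last
   coordinate. *)
Definition dt_part a : ext R N :=
  [ffun K : {set 'I_N} => if tc n \in K then 0 else a (tc n |: K)%SET].

Lemma dt_part_tc a K : tc n \in K -> dt_part a K = 0.
Proof. by move=> tK; rewrite ffunE tK. Qed.

Lemma dt_part0 : dt_part 0 = 0.
Proof. by apply/ffunP => K; rewrite !ffunE if_same. Qed.

Lemma dt_part_homogeneous k a : homogeneous k.+1 a -> homogeneous k (dt_part a).
Proof.
move=> ha K cK; rewrite ffunE; case: ifP => // tK.
by rewrite ha // cardsU1 tK.
Qed.

(** Only I = K \ {t} contributes: if t is in I, [dt_part] vanishes there; otherwise alpha is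
    evaluated at a set containing t, where it is nonzero only for {t}. *)
Lemma wedge_dt_part a p K : tc n \in K -> wedge (dt_part a) (alpha p) K = a K.
Proof.
move=> tK; rewrite ffunE (bigD1 (K :\ tc n)%SET) /=; last exact: finset.subD1set.
have -> : (K :\: (K :\ tc n))%SET = [set tc n]%SET.
  by rewrite finset.setDDr finset.setDv finset.set0U; apply/finset.setIidPr; rewrite finset.sub1set.
rewrite contact_form_tc ?finset.set11 // eqxx mulr1 ffunE finset.setD11 finset.setD1K //.
rewrite big1 ?addr0 => [|I /andP[sIK neI]].
  rewrite (_ : inversions _ _ = 0%N) ?mul1r // inversionsE big1 // => i _.
  by rewrite big_set1 /= ltnNge -ltnS ltn_ord.
case: (boolP (tc n \in I)) => tI; first by rewrite dt_part_tc // mulr0 mul0r.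
rewrite contact_form_tc ?finset.in_setD ?tI //.
case: eqP => [eI|]; last by rewrite mulr0.
case/eqP: neI; rewrite -eI finset.setDDr finset.setDv finset.set0U.
by apply/esym/finset.setIidPr.
Qed.

End HorizontalPart.

(** * Assembling beta and gamma *)

Theorem proposition2p14 (R : realType) (n k : nat)
    (kappa : diff_form R (2 * n).+1) :
  (n + 1 <= k <= 2 * n)%N ->
  Omega R (2 * n).+1 k kappa ->
  exists beta gamma : diff_form R (2 * n).+1,
    [/\ Omega R (2 * n).+1 (k - 1) beta /\ Omega R (2 * n).+1 (2 * n - k) gamma,
        without_dt beta /\ without_dt gamma,
        (forall p, kappa p = wedge (beta p) (contact_form R n p) +
           wedge (gamma p) (wedge_pow (ext_d (contact_form R n) p) (k - n))) &
        forall p, kappa p = 0 -> beta p = 0 /\ gamma p = 0].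
Proof.
move=> /andP[nk k2n] [hk sk]; pose m := (k - n)%N.
have kE : k = (k - 1).+1 by lia.
pose beta p := dt_part (kappa p).
pose a p := kappa p - wedge (beta p) (contact_form R n p).
have hbeta p : homogeneous (k - 1) (beta p).
  by apply: dt_part_homogeneous; rewrite -kE; exact: hk.
have sbeta (K : {set 'I_(2 * n).+1}) : smooth (fun p => beta p K).
  case: (boolP (tc n \in K)) => tK.
    rewrite (_ : (fun p => _) = fun=> 0); first exact: smooth_cst.
    by apply/funext => p; rewrite /beta dt_part_tc.
  rewrite (_ : (fun p => _) = fun p => kappa p (tc n |: K)%SET) //.
  by apply/funext => p; rewrite ffunE (negPf tK).
have atc p (K : {set 'I_(2 * n).+1}) : tc n \in K -> a p K = 0.
  by move=> tK; rewrite /a ffunE [X in _ + X]ffunE wedge_dt_part // subrr.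
have ha p : homogeneous k (a p).
  move=> K cK; rewrite /a ffunE [X in _ + X]ffunE hk // add0r.
  rewrite (homogeneous_wedge (hbeta p) (contact_form_homogeneous p)) ?oppr0 //.
  by rewrite addn1 -kE.
have sa (K : {set 'I_(2 * n).+1}) : smooth (fun p => a p K).
  (* Expand the wedge so that each term is a constant sign times a product of a smooth function with
     a coefficient of alpha. *)
  rewrite (_ : (fun p => _) = (fun p => kappa p K) \+ (fun p =>
      \sum_(I : {set 'I_(2 * n).+1} | I \subset K)
        - (-1) ^+ inversions I (K :\: I)%SET *
        (beta p I * contact_form R n p (K :\: I)%SET))).
    by apply: smoothD => //; apply: smooth_sum => I _; apply: smoothZ;
      exact: smooth_mul_contact_form.
  apply/funext => p; rewrite /a ffunE; congr (_ + _); rewrite !ffunE -sumrN.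
  by apply: eq_bigr => I _; rewrite mulNr mulrA.
(* Fix for each K a preimage [g K] of dz_K that does not depend on the point; the default is 0 when
   K contains t or has the wrong size. *)
have /choice[g gP] (K : {set 'I_(2 * n).+1}) : exists g : ext R (2 * n).+1,
    [/\ forall J : {set 'I_(2 * n).+1}, tc n \in J -> g J = 0,
        homogeneous (2 * n - k) g &
        tc n \notin K -> #|K| = k -> iter m (@contact_lefschetz R n) g = dzs R K].
  have [/andP[tK /eqP cK]|nK] := boolP ((tc n \notin K) && (#|K| == k)).
    have cK' : #|K| = (n + m)%N by rewrite cK /m; lia.
    have [g [g0 gh gL]] := contact_lefschetz_onto R tK cK'.
    by exists g; split=> //; apply: gh; rewrite /m; lia.
  exists 0; split=> [J _|J _|tK cK]; rewrite ?ffunE //.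
  by rewrite tK cK eqxx in nK.
(* At each point gamma is linear in [a p] with constant coefficients, so it inherits smoothness and
   zeros; 4^-m offsets the factor 4^m of (d alpha)^m. *)
pose gamma p : ext R (2 * n).+1 := \sum_K (4 ^- m * a p K) *: g K.
have gammaE p K : gamma p K = \sum_J g J K * 4 ^- m * a p J.
  rewrite sum_ffunE; apply: eq_bigr => J _.
  by rewrite ffunE [LHS]mulrC mulrA.
exists beta, gamma; split.
- split; split=> //.
    move=> p K cK; rewrite gammaE big1 // => J _.
    by have [_ hJ _] := gP J; rewrite hJ // !mul0r.
  move=> K; rewrite (_ : (fun p => _) = fun p => \sum_J g J K * 4 ^- m * a p J).
    by apply: smooth_sum => J _; exact: smoothZ.
  by apply/funext => p; exact: gammaE.
- split; apply: without_dtP => p K tK; first exact: dt_part_tc.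
  rewrite gammaE big1 // => J _.
  by have [gJ _ _] := gP J; rewrite gJ // !mul0r.
- move=> p; rewrite wedge_pow_contact -/m.
  suff -> : 4 ^+ m *: iter m (@contact_lefschetz R n) (gamma p) = a p.
    by rewrite /a addrC subrK.
  rewrite /contact_lefschetz linear_sum scaler_sumr [RHS]ext_sum_dzs.
  apply: eq_bigr => K _; rewrite linearZ_LR scalerA mulrA divff ?expf_neq0 ?pnatr_eq0 //.
  (* Where [g K] is only the default, the coefficient [a p K] is 0. *)
  rewrite mul1r; have [tK|tK] := boolP (tc n \in K); first by rewrite atc // !scale0r.
  have [cK|cK] := eqVneq #|K| k; last by rewrite ha // !scale0r.
  by have [_ _ <-] := gP K.
move=> p kp0; have b0 : beta p = 0 by rewrite /beta kp0 dt_part0.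
split=> //; rewrite /gamma big1 // => K _.
by rewrite /a kp0 b0 wedge0l subr0 ffunE mulr0 scale0r.
Qed.
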